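(* Let $n \ge 1$ and $m \ge 2$ be integers, and let $D_n^m$ be the graph obtained from two disjoint copies $K_{n,1}$, $K_{n,2}$ of the complete graph $K_n$ and a path $P_m$ on $m$ vertices by identifying one endpoint of $P_m$ with a vertex of $K_{n,1}$ and the other endpoint of $P_m$ with a vertex of $K_{n,2}$ (so $D_n^m$ has $2n+m-2$ vertices). Then $$\frac{2}{(2n+m-3)(m+1)} \le \lambda_2(D_n^m) \le \frac{12}{6(m-1)(n-1)+m(m-1)}.$$
   Context: All graphs are finite, simple and unweighted. For a graph $G$ with adjacency matrix $A$ and diagonal degree matrix $D$, the graph Laplacian is $L_G = D - A$, whose quadratic form is $x^T L_G x = \sum_{(a,b)\in E}(x(a)-x(b))^2$; its eigenvalues are ordered $0=\lambda_1 \le \lambda_2 \le \dots$, and $\lambda_2(G)$ denotes the second smallest eigenvalue of $L_G$. $P_m$ denotes the path graph with $m$ vertices. *)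

(* Defs.v *)
From HB Require Import structures.
From mathcomp Require Import all_boot all_order all_algebra.
From mathcomp Require Import boolp classical_sets reals.
Set Implicit Arguments. Unset Strict Implicit. Unset Printing Implicit Defensive.
Import Order.TTheory GRing.Theory Num.Theory.
Local Open Scope ring_scope.

Section Laplacian.
Variables (R : realType) (N : nat) (adj : rel 'I_N).

Definition adjmx : 'M[R]_N := \matrix_(i, j) (adj i j)%:R.
Definition degree (i : 'I_N) : nat := #|[set j | adj i j]|.
Definition degmx : 'M[R]_N := diag_mx (\row_i (degree i)%:R).
Definition laplacian : 'M[R]_N := degmx - adjmx.
End Laplacian.

Definition is_spectrum (R : realType) (N : nat) (M : 'M[R]_N) (s : seq R) : bool :=
  sorted <=%R s && (char_poly M == \prod_(x <- s) ('X - x%:P)).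

Definition spectrum (R : realType) (N : nat) (M : 'M[R]_N) : seq R :=
  xget [::] (fun s => is_spectrum M s).

(* second smallest eigenvalue (index 1 since lists are 0-indexed) *)
Definition lambda2 (R : realType) (N : nat) (adj : rel 'I_N) : R :=
  (spectrum (laplacian R adj))`_1.

(* The graph D_n^m on vertices 0 .. 2n+m-3:
   K_{n,1} = {0, ..., n-1}, path P_m = n-1, n, ..., n+m-2,
   K_{n,2} = {n+m-2, ..., 2n+m-3}.  The path endpoint n-1 is identified with
   a vertex of K_{n,1}, the endpoint n+m-2 with a vertex of K_{n,2}. *)
Definition Dnm_adj (n m : nat) : rel 'I_(2 * n + m - 2) :=
  fun i j =>
    (i != j) &&
    [|| ((i < n)%N && (j < n)%N),
        ((n + m - 2 <= i)%N && (n + m - 2 <= j)%N)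
      | [&& ((i.+1 == j) || (j.+1 == i)),
            (n - 1 <= i <= n + m - 2)%N & (n - 1 <= j <= n + m - 2)%N]].

Arguments Dnm_adj n m : clear implicits.
Arguments lambda2 R {N} adj.

(* Main.v *)
(** A real symmetric matrix has a real spectrum and, over the complex numbers,
    a unitary diagonalisation; this yields both halves of the Courant-Fischer
    principle for the second smallest eigenvalue.

    Lower bound: if x sums to 0, then 2 N |x|^2 is the sum of (x a - x b)^2
    over all ordered pairs (a, b).  Any two vertices are joined by a path of at
    most m + 1 edges of a spanning tree, so by Cauchy-Schwarz each of the
    N (N - 1) off-diagonal terms is at most (m + 1) x^T L x.

    Upper bound: the test vector that is constant on each clique and increases
    linearly along the path, normalised to sum to 0, has an explicit Rayleigh
    quotient. *)

Require Import Defs.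
From HB Require Import structures.
From mathcomp Require Import all_boot all_order all_algebra.
From mathcomp Require Import fingroup perm.
From mathcomp Require Import boolp classical_sets reals.
From mathcomp Require Import complex zify ring lra.
Import Order.TTheory GRing.Theory Num.Theory.
Local Open Scope ring_scope.
Local Open Scope sesquilinear_scope.

Local Notation toC := (real_complex _).
Local Notation Rec := (@complex.Re _).
Local Notation Imc := (@complex.Im _).

(** * Courant-Fischer for the second eigenvalue *)

Lemma char_poly_similar {F : fieldType} {n : nat} (P D : 'M[F]_n) :
  P \in unitmx -> char_poly (invmx P *m D *m P) = char_poly D.
Proof.
move=> uP; rewrite /char_poly.
have -> : char_poly_mx (invmx P *m D *m P) =
    map_mx polyC (invmx P) *m char_poly_mx D *m map_mx polyC P.
  rewrite /char_poly_mx mulmxBr mulmxBl !map_mxM scalar_mxC.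
  by rewrite -(mulmxA 'X%:M) -[map_mx _ (invmx P) *m map_mx _ P]map_mxM mulVmx // map_mx1 mulmx1.
by rewrite !det_mulmx mulrAC -det_mulmx -map_mxM mulVmx // map_mx1 det1 mul1r.
Qed.

(** The choice in [spectrum] never falls back on its default: the spectral theorem over the complex
    numbers supplies a sorted list of real roots, and unique factorisation of the characteristic
    polynomial makes it the only one. *)
Lemma spectrum_sym {R : realType} {N : nat} {M : 'M[R]_N} : M^T = M ->
  [/\ size (spectrum M) = N, sorted <=%R (spectrum M) &
   exists2 P : 'M[R[i]]_N, P \is unitarymx &
     map_mx toC M = P^t* *m diag_mx (\row_k ((spectrum M)`_k)%:C%C) *m P].
Proof.
move=> symM; set A := map_mx toC M.
have hermA : A \is hermsymmx.
  apply: realsym_hermsym.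
    apply/is_hermitianmxP; rewrite expr0 scale1r map_mx_id //.
    by rewrite /A map_trmx symM.
  by apply/mxOverP => i j; rewrite mxE; apply/complex_realP; eexists.
set P := spectralmx A; pose d := \row_k complex.Re (spectral_diag A 0 k).
have dE : spectral_diag A = map_mx toC d.
  apply/rowP => k; rewrite !mxE RRe_real //.
  by have /mxOverP/(_ 0 k) := hermitian_spectral_diag_real hermA.
have AE := orthomx_spectralP (hermitian_normalmx hermA).
rewrite -/P dE in AE.
have cpM : char_poly M = \prod_(x <- [tuple d 0 k | k < N]) ('X - x%:P).
  apply: (map_poly_inj toC).
  rewrite map_char_poly -/A AE char_poly_similar ?spectral_unit //.
  rewrite char_poly_trig ?diag_mx_is_trig // map_prod_XsubC big_map.
  rewrite val_ord_tuple big_enum; by apply: eq_bigr => k _; rewrite !mxE eqxx.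
set t := [tuple d 0 k | k < N] in cpM.
have sortP : perm_eq (sort_tuple <=%R t) t by rewrite /= perm_sort.
have spE : spectrum M = sort <=%R t.
  apply: xget_unique => [|s /andP[s_sorted /eqP cps]].
    apply/andP; split; first by apply: sort_sorted; apply: le_total.
    by rewrite cpM; apply/eqP/perm_big; rewrite perm_sym perm_sort.
  apply: (sorted_eq le_trans le_anti) => //.
    by apply: sort_sorted; apply: le_total.
  rewrite perm_sym perm_sort perm_sym.
  by apply: prod_XsubC_eq; rewrite -cps cpM.
split; first by rewrite spE size_sort size_tuple.
  by rewrite spE; apply: sort_sorted; apply: le_total.
have [s sE] := tuple_permP sortP.
(* Sorting permutes the eigenvalues, so the eigenvectors, which are the rows of [P], are permuted
   alike. *)
exists (row_perm s P).
  by rewrite row_permE mul_unitarymx ?spectral_unitarymx //;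
    apply/unitarymxP; rewrite tr_perm_mx map_perm_mx -perm_mxM mulgV perm_mx1.
rewrite AE invmx_unitary ?spectral_unitarymx //.
apply/matrixP => i j; rewrite mul_mx_diag mul_mx_diag !mxE.
rewrite [LHS](reindex_inj (@perm_inj _ s)) /=; apply: eq_bigr => k _.
rewrite !mxE; do 2 congr (_ * _).
have -> : (spectrum M)`_k = d 0 (s k); last by rewrite mxE.
by rewrite spE sE -tnth_nth !tnth_mktuple.
Qed.

Definition qform {R : pzRingType} {N : nat} (M : 'M[R]_N) (x : 'I_N -> R) : R :=
  \sum_i \sum_j x i * M i j * x j.

Lemma Re_sum {R : rcfType} {I : finType} (F : I -> R[i]) :
  Rec (\sum_i F i) = \sum_i Rec (F i).
Proof. by apply: (big_morph Rec) => // -[a b] [c d]. Qed.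

Lemma Im_sum {R : rcfType} {I : finType} (F : I -> R[i]) :
  Imc (\sum_i F i) = \sum_i Imc (F i).
Proof. by apply: (big_morph Imc) => // -[a b] [c d]. Qed.

(* In a complex eigenbasis the real form is evaluated at the real and imaginary
   parts of [z], so that no real eigenbasis is needed. *)
Lemma qform_unitary {R : rcfType} {N : nat} {M : 'M[R]_N} {P : 'M[R[i]]_N}
    (t : 'I_N -> R) (z : 'rV[R[i]]_N) :
  map_mx toC M = P^t* *m diag_mx (\row_k (t k)%:C%C) *m P ->
  let y := z *m P^t* in
  qform M (fun i => Rec (z 0 i)) + qform M (fun i => Imc (z 0 i)) =
  \sum_k t k * (Rec (y 0 k) ^+ 2 + Imc (y 0 k) ^+ 2).
Proof.
move=> ME y.
have : z *m map_mx toC M *m z^t* = y *m diag_mx (\row_k (t k)%:C%C) *m y^t*.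
  by rewrite ME /y trmx_mul map_mxM trmxCK !mulmxA.
move=> /matrixP/(_ 0 0)/(congr1 Rec).
rewrite mul_mx_diag ![in X in X -> _]mxE !Re_sum => zE.
rewrite /qform exchange_big [X in _ + X]exchange_big -big_split /=.
(* As [M] is real, the real part of each term keeps only the products real-real and
   imaginary-imaginary; the mixed products are purely imaginary. *)
transitivity (\sum_j Rec ((z *m map_mx toC M) 0 j * (z^t*) j 0)).
  apply: eq_bigr => j _ /=; rewrite !mxE mulr_suml Re_sum -big_split.
  apply: eq_bigr => i _ /=; rewrite !mxE.
  by case: (z 0 i) => a b; case: (z 0 j) => c d /=; ring.
rewrite zE; apply: eq_bigr => k _; rewrite !mxE.
by set w := \sum_j _; case: w => a b /=; ring.
Qed.

Lemma qform_subscalar {R : comPzRingType} {N : nat} (M : 'M[R]_N) (c : R)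
    (x : 'I_N -> R) :
  qform (M - c%:M) x = qform M x - c * \sum_i x i ^+ 2.
Proof.
rewrite /qform mulr_sumr -sumrB; apply: eq_bigr => i _.
rewrite (bigD1 i) //= [in RHS](bigD1 i) //= !mxE eqxx mulr1n.
rewrite (eq_bigr (fun j => x i * M i j * x j)) => [|j neq_ji]; first by ring.
by rewrite !mxE eq_sym (negbTE neq_ji) mulr0n subr0.
Qed.

(** Subtracting [c%:M] shifts every eigenvalue by [c], so comparing the form with [c] times the
    squared norm reduces to the signs of the shifted eigenvalues. *)
Lemma qform_spectrum {R : realType} {N : nat} {M : 'M[R]_N} : M^T = M ->
  exists2 P : 'M[R[i]]_N, P \is unitarymx & forall (c : R) (z : 'rV[R[i]]_N),
    let y := z *m P^t* in
    (qform M (fun i => Rec (z 0 i)) - c * \sum_i Rec (z 0 i) ^+ 2) +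
    (qform M (fun i => Imc (z 0 i)) - c * \sum_i Imc (z 0 i) ^+ 2) =
    \sum_(k < N) ((spectrum M)`_k - c) * (Rec (y 0 k) ^+ 2 + Imc (y 0 k) ^+ 2).
Proof.
move=> symM; have [_ _ [P uP ME]] := spectrum_sym symM.
exists P => // c z /=; rewrite -!qform_subscalar; apply: qform_unitary.
have PP : P^t* *m P = 1%:M.
  by rewrite -invmx_unitary // mulVmx // unitarymx_unit.
have -> : diag_mx (\row_(k < N) ((spectrum M)`_k - c)%:C%C) =
    diag_mx (\row_k ((spectrum M)`_k)%:C%C) - (c%:C%C)%:M.
  apply/matrixP => i j; rewrite !mxE -mulrnBl; congr (_ *+ _).
  exact: rmorphB.
rewrite mulmxBr mulmxBl -ME mul_mx_scalar -scalemxAl PP scalemx1.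
by rewrite map_mxB map_scalar_mx.
Qed.

Lemma sqReIm_ge0 {R : rcfType} (z : R[i]) : 0 <= Rec z ^+ 2 + Imc z ^+ 2.
Proof. by rewrite addr_ge0 ?sqr_ge0. Qed.

Lemma sqReIm_eq0 {R : rcfType} (z : R[i]) :
  (Rec z ^+ 2 + Imc z ^+ 2 == 0) = (z == 0).
Proof.
by rewrite paddr_eq0 ?sqr_ge0 // !sqrf_eq0 eq_complex.
Qed.

Lemma exists_combination {F : fieldType} (a b : F) :
  exists u v : F, (u != 0) || (v != 0) /\ u * a + v * b = 0.
Proof.
have [->|a0] := eqVneq a 0.
  by exists 1, 0; rewrite oner_eq0; split => //; ring.
by exists b, (- a); rewrite oppr_eq0 a0 orbT; split => //; ring.
Qed.

(** If the second eigenvalue were below [c], so would be the first. The plane of the first two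
    eigenvectors meets the hyperplane orthogonal to [w] in a nonzero vector, where the form would be
    strictly below [c] times the squared norm. Since [w] is real, the real and imaginary parts of
    that vector are both orthogonal to [w]. *)
Lemma spectrum1_ge {R : realType} {N : nat} {M : 'M[R]_N} (w : 'I_N -> R) (c : R) :
  M^T = M -> (1 < N)%N ->
  (forall x : 'I_N -> R, \sum_i x i * w i = 0 ->
     c * \sum_i x i ^+ 2 <= qform M x) ->
  c <= (spectrum M)`_1.
Proof.
move=> symM N1 Hc; rewrite leNgt; apply/negP => s1c.
have [size_s s_sorted _] := spectrum_sym symM.
have s0c : (spectrum M)`_0 < c.
  apply: le_lt_trans s1c; apply: (sorted_leq_nth le_trans le_refl 0 s_sorted) => //;
    by rewrite inE size_s // ltnW.
have [P uP qE] := qform_spectrum symM.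
pose wC := \col_i (w i)%:C%C.
pose i0 := Ordinal (ltnW N1); pose i1 := Ordinal N1.
have [u [v [uv0 uvE]]] := exists_combination ((P *m wC) i0 0) ((P *m wC) i1 0).
pose y : 'rV_N := u *: delta_mx 0 i0 + v *: delta_mx 0 i1.
pose z := y *m P.
have zw : z *m wC = 0.
  apply/matrixP => i j; rewrite !ord1 -mulmxA mulmxDl -!scalemxAl -!rowE.
  by rewrite !mxE -[RHS]uvE !mxE.
have zw0 : \sum_i z 0 i * (w i)%:C%C = 0.
  transitivity ((z *m wC) 0 0); last by rewrite zw mxE.
  by rewrite [RHS]mxE; apply: eq_bigr => i _; rewrite [wC _ _]mxE.
have zP : z *m P^t* = y by rewrite /z mulmxtVK.
have := qE c z; rewrite /= zP => E.
have : 0 <= \sum_(k < N) ((spectrum M)`_k - c) * (Rec (y 0 k) ^+ 2 + Imc (y 0 k) ^+ 2).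
  rewrite -E; apply: addr_ge0; rewrite subr_ge0; apply: Hc.
    rewrite -[RHS](congr1 Rec zw0) Re_sum; apply: eq_bigr => i _.
    by case: (z 0 i) => a b /=; ring.
  rewrite -[RHS](congr1 Imc zw0) Im_sum; apply: eq_bigr => i _.
  by case: (z 0 i) => a b /=; ring.
rewrite (bigD1 i0) //= (bigD1 i1) //= big1 => [|k /andP[ki0 ki1]]; last first.
  by rewrite !mxE (negbTE ki0) (negbTE ki1) !mulr0 addr0 /= expr0n /= addr0 mulr0.
have -> : y 0 i0 = u by rewrite !mxE /= mulr1 mulr0 addr0.
have -> : y 0 i1 = v by rewrite !mxE /= mulr1 mulr0 add0r.
apply/negP; rewrite -ltNge addr0.
have d0 : (spectrum M)`_0 - c < 0 by rewrite subr_lt0.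
have d1 : (spectrum M)`_1 - c < 0 by rewrite subr_lt0.
have neg (a : R) (x : R[i]) : a < 0 -> a * (Rec x ^+ 2 + Imc x ^+ 2) <= 0.
  by move=> /ltW a0; rewrite mulr_le0_ge0 ?sqReIm_ge0.
have sneg (a : R) (x : R[i]) : x != 0 -> a < 0 ->
    a * (Rec x ^+ 2 + Imc x ^+ 2) < 0.
  by move=> x0 a0; rewrite nmulr_rlt0 // lt0r sqReIm_ge0 sqReIm_eq0 x0.
have [u0|] := boolP (u != 0).
  by apply: ltr_nwDl; [apply: sneg|apply: neg].
move=> u0; rewrite (negbTE u0) /= in uv0.
by apply: ltr_wnDl; [apply: neg|apply: sneg].
Qed.

(** Dually, the complex span of [x1] and [x2] contains a nonzero vector with no component along the
    first eigenvector. If [c] were below the second eigenvalue, all remaining weights would be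
    positive, and a sum that is at most 0 would force this vector to vanish. *)
Lemma spectrum1_le {R : realType} {N : nat} {M : 'M[R]_N} (x1 x2 : 'I_N -> R) (c : R) :
  M^T = M -> (1 < N)%N ->
  (forall a b : R, (forall i, a * x1 i + b * x2 i = 0) -> a = 0 /\ b = 0) ->
  (forall a b : R, let x i := a * x1 i + b * x2 i in
     qform M x <= c * \sum_i x i ^+ 2) ->
  (spectrum M)`_1 <= c.
Proof.
move=> symM N1 free Hc; rewrite leNgt; apply/negP => s1c.
have [size_s s_sorted _] := spectrum_sym symM.
have [P uP qE] := qform_spectrum symM.
pose i0 := Ordinal (ltnW N1).
pose X1 : 'rV_N := \row_i (x1 i)%:C%C; pose X2 : 'rV_N := \row_i (x2 i)%:C%C.
have [u [v [uv0 uvE]]] :=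
  exists_combination ((X1 *m P^t*) 0 i0) ((X2 *m P^t*) 0 i0).
pose z := u *: X1 + v *: X2; pose y := z *m P^t*.
have y0 : y 0 i0 = 0 by rewrite /y mulmxDl -!scalemxAl mxE [X in X + _]mxE [X in _ + X]mxE.
have reE i : Rec (z 0 i) = Rec u * x1 i + Rec v * x2 i.
  by rewrite !mxE; case: (u) => a b; case: (v) => a' b' /=; ring.
have imE i : Imc (z 0 i) = Imc u * x1 i + Imc v * x2 i.
  by rewrite !mxE; case: (u) => a b; case: (v) => a' b' /=; ring.
have Hf (a b : R) f : (forall i, f i = a * x1 i + b * x2 i) ->
    qform M f <= c * \sum_i f i ^+ 2.
  by move=> fE; have -> := funext fE; exact: Hc.
have := qE c z; rewrite /= -/y => E.
have F0 (k : 'I_N) : true ->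
    0 <= ((spectrum M)`_k - c) * (Rec (y 0 k) ^+ 2 + Imc (y 0 k) ^+ 2).
  have [->|k_neq0 _] := eqVneq k i0.
    by rewrite y0 /= expr0n /= addr0 mulr0.
  rewrite mulr_ge0 ?sqReIm_ge0 // subr_ge0 (le_trans (ltW s1c)) //.
  apply: (sorted_leq_nth le_trans le_refl 0 s_sorted); rewrite ?inE ?size_s //.
  by rewrite lt0n; apply: contraNneq k_neq0 => k0; apply/eqP/val_inj.
have : \sum_(k < N) ((spectrum M)`_k - c) * (Rec (y 0 k) ^+ 2 + Imc (y 0 k) ^+ 2) == 0.
  rewrite eq_le sumr_ge0 // andbT -E.
  rewrite -[leRHS]addr0 lerD // subr_le0.
    exact: Hf reE.
  exact: Hf imE.
rewrite psumr_eq0 // => /allP yk0.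
have yE : y = 0.
  apply/rowP => k; rewrite [RHS]mxE; have [->//|k_neq0] := eqVneq k i0.
  have /implyP/(_ isT) := yk0 k (mem_index_enum _); rewrite mulf_eq0 sqReIm_eq0.
  case/orP => [|/eqP//]; rewrite subr_eq0 => /eqP skc; move: s1c.
  rewrite ltNge -skc (sorted_leq_nth le_trans le_refl 0 s_sorted) ?inE ?size_s //.
  by rewrite lt0n; apply: contraNneq k_neq0 => k0; apply/eqP/val_inj.
have zE : z = 0 by rewrite -[z](@mulmxKtV _ _ _ _ _ P) // -/y yE mul0mx.
have [ur vr] : Rec u = 0 /\ Rec v = 0 by apply: free => i; rewrite -reE zE mxE.
have [ui vi] : Imc u = 0 /\ Imc v = 0 by apply: free => i; rewrite -imE zE mxE.
by case/orP: uv0; rewrite -sqReIm_eq0 ?ur ?ui ?vr ?vi expr0n addr0 eqxx.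
Qed.

(** * Laplacians of arbitrary graphs *)

Lemma laplacian_sym {R : realType} {N : nat} {adj : rel 'I_N} :
  symmetric adj -> (laplacian R adj)^T = laplacian R adj.
Proof.
move=> adjC; apply/matrixP => i j; rewrite !mxE adjC.
by have [->|ij] := eqVneq j i; rewrite ?eqxx // eq_sym (negbTE ij).
Qed.

Lemma qform_laplacian {R : realType} {N : nat} {adj : rel 'I_N} (x : 'I_N -> R) :
  symmetric adj ->
  2 * qform (laplacian R adj) x = \sum_i \sum_j (adj i j)%:R * (x i - x j) ^+ 2.
Proof.
move=> adjC; pose a i j : R := (adj i j)%:R.
have degE i : (degree adj i)%:R = \sum_j a i j.
  by rewrite /degree cardsE -sum1_card natr_sum big_mkcond;
    apply: eq_bigr => j _; rewrite /a unfold_in; case: (adj i j).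
have -> : qform (laplacian R adj) x =
    \sum_i \sum_j a i j * x i ^+ 2 - \sum_i \sum_j a i j * (x i * x j).
  rewrite /qform -sumrB; apply: eq_bigr => i _.
  rewrite -mulr_suml -degE (bigD1 i) //= [in RHS](bigD1 i) //= !mxE eqxx mulr1n.
  rewrite (eq_bigr (fun j => - (a i j * (x i * x j)))) => [|j neq_ji].
    by rewrite sumrN /a; ring.
  by rewrite !mxE eq_sym (negbTE neq_ji) mulr0n sub0r /a; ring.
have swap : \sum_i \sum_j a i j * x i ^+ 2 = \sum_i \sum_j a i j * x j ^+ 2.
  rewrite exchange_big; apply: eq_bigr => i _; apply: eq_bigr => j _.
  by rewrite /a adjC.
rewrite mulrBr mulr_natl mulr2n {2}swap -big_split /= mulr_sumr -sumrB.
apply: eq_bigr => i _; rewrite -big_split mulr_sumr -sumrB /=.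
by apply: eq_bigr => j _; rewrite -/(a i j); ring.
Qed.

Lemma sum_sqr_sub {R : realType} {N : nat} (x : 'I_N -> R) :
  \sum_i \sum_j (x i - x j) ^+ 2 =
  2 * N%:R * \sum_i x i ^+ 2 - 2 * (\sum_i x i) ^+ 2.
Proof.
transitivity (\sum_i (N%:R * x i ^+ 2 + \sum_j x j ^+ 2
                        - 2 * x i * \sum_j x j)).
  apply: eq_bigr => i _; rewrite mulr_sumr mulr_natl.
  have -> (c : R) : c *+ N = \sum_(j < N) c by rewrite sumr_const card_ord.
  rewrite -big_split -sumrB; apply: eq_bigr => j _ /=; ring.
rewrite sumrB big_split /= -mulr_suml -!mulr_sumr sumr_const card_ord -[_ *+ N]mulr_natl.
ring.
Qed.

(** Lagrange's identity: twice the gap is a sum of squares of 2 by 2 minors. *)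
Lemma sum_CauchySchwarz {R : realType} {N : nat} (e y : 'I_N -> R) :
  (\sum_i e i * y i) ^+ 2 <= (\sum_i e i ^+ 2) * \sum_i y i ^+ 2.
Proof.
rewrite -subr_ge0 -(pmulr_rge0 _ (ltr0n R 2)).
have -> : 2 * ((\sum_i e i ^+ 2) * (\sum_i y i ^+ 2) - (\sum_i e i * y i) ^+ 2) =
    \sum_i \sum_j (e i * y j - e j * y i) ^+ 2.
  transitivity (\sum_i (e i ^+ 2 * (\sum_j y j ^+ 2) + y i ^+ 2 * (\sum_j e j ^+ 2)
                          - 2 * (e i * y i) * \sum_j (e j * y j))).
    by rewrite sumrB big_split /= -!mulr_suml -mulr_sumr; ring.
  apply: eq_bigr => i _; rewrite !mulr_sumr -big_split -sumrB.
  by apply: eq_bigr => j _ /=; ring.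
by apply: sumr_ge0 => i _; apply: sumr_ge0 => j _; apply: sqr_ge0.
Qed.

Lemma lambda2_ge_pairs {R : realType} {N : nat} {adj : rel 'I_N} (D : nat) :
  symmetric adj -> (1 < N)%N -> (0 < D)%N ->
  (forall (x : 'I_N -> R) a b,
     (x a - x b) ^+ 2 <= D%:R * qform (laplacian R adj) x) ->
  2 / (N.-1%:R * D%:R) <= lambda2 R adj.
Proof.
move=> adjC N1 D0 HD; apply: (spectrum1_ge (fun=> 1)) => //.
  exact: laplacian_sym.
move=> x; under eq_bigr do rewrite mulr1; move=> sx0.
have := sum_sqr_sub x; rewrite sx0 expr0n mulr0 subr0.
set S := \sum_i x i ^+ 2; set q := qform _ _ => SE.
have : \sum_i \sum_j (x i - x j) ^+ 2 <= \sum_(i < N) N.-1%:R * (D%:R * q).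
  (* Dropping the zero diagonal term leaves [N.-1] terms per row, whence [N.-1] rather than [N] in
     the bound. *)
  apply: ler_sum => i _; rewrite (bigD1 i) //= subrr expr0n add0r.
  rewrite mulr_natl -[in _ *+ N.-1](card_ord N) -(cardC1 i) -sumr_const.
  by apply: ler_sum => j _; apply: HD.
rewrite SE sumr_const card_ord -[leRHS]mulr_natl.
have N0 : 0 < N%:R :> R by rewrite ltr0n ltnW.
rewrite [2 * _]mulrC -mulrA ler_pM2l // => HS.
have DN0 : 0 < N.-1%:R * D%:R :> R by rewrite mulr_gt0 ?ltr0n // -ltnS prednK // ltnW.
by rewrite mulrAC ler_pdivrMr // [q * _]mulrC -mulrA.
Qed.

(** The trial plane is spanned by [v] and the constants. Constants do not change the form and are
    orthogonal to [v], so they only add a nonnegative term to the right-hand side. *)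
Lemma lambda2_le_test {R : realType} {N : nat} {adj : rel 'I_N} (v : 'I_N -> R) (c : R) :
  symmetric adj -> (1 < N)%N -> \sum_i v i = 0 -> 0 < \sum_i v i ^+ 2 -> 0 <= c ->
  qform (laplacian R adj) v <= c * \sum_i v i ^+ 2 ->
  lambda2 R adj <= c.
Proof.
move=> adjC N1 sv0 v2 c0 qv; have N0 : 0 < N%:R :> R by rewrite ltr0n ltnW.
apply: (spectrum1_le (fun=> 1) v) => //; first exact: laplacian_sym.
  move=> a b ab0; have a0 : a = 0.
    have : \sum_(i < N) (a * 1 + b * v i) = 0 by apply: big1.
    rewrite big_split /= sumr_const card_ord -mulr_sumr sv0 mulr0 addr0 mulr1.
    by move/eqP; rewrite -mulr_natl mulf_eq0 (gt_eqF N0) => /eqP.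
  split=> //; apply/eqP; apply: contraLR v2 => b0; rewrite -leNgt.
  rewrite big1 // => i _; have /eqP := ab0 i.
  by rewrite a0 mul0r add0r mulf_eq0 (negbTE b0) => /eqP ->; rewrite expr0n.
move=> a b /=; set x := fun i => _.
have -> : qform (laplacian R adj) x = b ^+ 2 * qform (laplacian R adj) v.
  apply: (@mulfI _ (2 : R)); first by rewrite pnatr_eq0.
  rewrite mulrCA !qform_laplacian // mulr_sumr; apply: eq_bigr => i _.
  by rewrite mulr_sumr; apply: eq_bigr => j _; rewrite /x; ring.
have -> : \sum_i x i ^+ 2 = a ^+ 2 * N%:R + b ^+ 2 * \sum_i v i ^+ 2.
  transitivity (\sum_(i < N) (a ^+ 2 + (2 * a * b) * v i + b ^+ 2 * v i ^+ 2)).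
    by apply: eq_bigr => i _; rewrite /x; ring.
  rewrite !big_split /= sumr_const card_ord -!mulr_sumr sv0 mulr0 addr0.
  by rewrite mulr_natr.
rewrite mulrDr -[leLHS]add0r; apply: lerD.
  by rewrite mulr_ge0 // mulr_ge0 ?sqr_ge0 ?ler0n.
by rewrite mulrCA ler_wpM2l ?sqr_ge0.
Qed.

(** Each non-fixed [v] selects the edge to [p v]; fixed points contribute 0. Excluding 2-cycles of
    [p] ensures that no edge is selected from both ends, so the left side sums over distinct
    edges. *)
Lemma qform_laplacian_forest {R : realType} {N : nat} {adj : rel 'I_N}
    (p : 'I_N -> 'I_N) (x : 'I_N -> R) :
  symmetric adj -> (forall v, v != p v -> adj v (p v)) ->
  (forall u v, v = p u -> u = p v -> u = v) ->
  \sum_v (x v - x (p v)) ^+ 2 <= qform (laplacian R adj) x.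
Proof.
move=> adjC adjp acyclic.
rewrite -(ler_pM2l (ltr0n R 2)) qform_laplacian //.
have pE : \sum_v (x v - x (p v)) ^+ 2 =
    \sum_i \sum_j (j == p i)%:R * (x i - x j) ^+ 2.
  apply: eq_bigr => i _; rewrite (bigD1 (p i)) //= eqxx mul1r big1 ?addr0 //.
  by move=> j /negbTE ->; rewrite mul0r.
have pE' : \sum_v (x v - x (p v)) ^+ 2 =
    \sum_i \sum_j (i == p j)%:R * (x i - x j) ^+ 2.
  rewrite pE exchange_big; apply: eq_bigr => i _; apply: eq_bigr => j _ /=.
  by ring.
rewrite mulr_natl mulr2n {1}pE pE' -big_split /=.
apply: ler_sum => i _; rewrite -big_split /=; apply: ler_sum => j _.
rewrite -mulrDl; have [->|neq_ij] := eqVneq i j.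
  by rewrite subrr expr0n !mulr0.
rewrite ler_wpM2r ?sqr_ge0 // -natrD ler_nat.
have [jE|_] := eqVneq j (p i); have [iE|_] := eqVneq i (p j) => //.
- by case/eqP: neq_ij; apply: acyclic.
- by rewrite jE adjp // -jE.
- by rewrite adjC iE adjp // -iE eq_sym.
Qed.

(** * The graph [D_n^m] *)

(* Parents in the spanning tree rooted at [n - 1]; the root is its own parent. *)
Definition Dnm_parent (n m v : nat) : nat :=
  if (v < n)%N then (n - 1)%N else if (v <= n + m - 2)%N then (v - 1)%N
  else (n + m - 2)%N.

(* The vertices [v] whose edge to their parent lies on the tree path from [a]
   to the root [n - 1]. *)
Definition Dnm_ancestor (n m a v : nat) : bool :=
  ((v == a) && (a != n - 1)%N) || (n <= v <= minn a (n + m - 2))%N.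

Lemma Dnm_adj_sym (n m : nat) : symmetric (Dnm_adj n m).
Proof. by move=> i j; rewrite /Dnm_adj eq_sym; apply/idP/idP; lia. Qed.

Lemma Dnm_ancestor_root (n m v : nat) : (1 <= n)%N ->
  Dnm_ancestor n m (n - 1) v = false.
Proof. rewrite /Dnm_ancestor; lia. Qed.

(** The root path of [a] is its parent edge followed by the root path of its parent. The sum in
    [nat] also records that the two are disjoint. *)
Lemma Dnm_ancestor_parent (n m a v : nat) : (1 <= n)%N -> (2 <= m)%N ->
  a != (n - 1)%N ->
  (Dnm_ancestor n m a v = (v == a) + Dnm_ancestor n m (Dnm_parent n m a) v :> nat)%N.
Proof.
move=> n1 m2 an; rewrite /Dnm_ancestor /Dnm_parent; have [->|va] := eqVneq v a.
  by case: ifP => ?; [|case: ifP => ?]; lia.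
by case: ifP => ?; [|case: ifP => ?]; lia.
Qed.

(** Apart from the edges above [a] and [b] themselves, root paths use only the edges of the path.
    Summed over [v], the bound is 1 + 1 + (m - 1) = m + 1. *)
Lemma Dnm_ancestor_diff (n m a b v : nat) :
  ((Dnm_ancestor n m a v != Dnm_ancestor n m b v)
     <= (v == a) + (v == b) + (n <= v < n + m - 1))%N.
Proof.
rewrite /Dnm_ancestor; have [->|va] := eqVneq v a.
  exact: leq_trans (leq_b1 _) (leq_addr _ _).
have [->|vb] := eqVneq v b; first by case: (_ != _); rewrite ?leqnSn //= addnS.
by rewrite /= !leq_min; case: (leqP n v) => /= nv; lia.
Qed.

Lemma Dnm_parent_lt (n m : nat) (v : 'I_(2 * n + m - 2)) :
  (1 <= n)%N -> (2 <= m)%N -> (Dnm_parent n m v < 2 * n + m - 2)%N.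
Proof.
move=> n1 m2; have := ltn_ord v; rewrite /Dnm_parent.
by case: ifP => ?; [|case: ifP => ?]; lia.
Qed.

Lemma Dnm_path_sum {R : realType} {n m : nat}
    (x : 'I_(2 * n + m - 2) -> R) (p : 'I_(2 * n + m - 2) -> 'I_(2 * n + m - 2))
    (r a : 'I_(2 * n + m - 2)) :
  (1 <= n)%N -> (2 <= m)%N -> r = (n - 1)%N :> nat ->
  (forall v : 'I_(2 * n + m - 2), p v = Dnm_parent n m v :> nat) ->
  x a = x r + \sum_(v < 2 * n + m - 2) (Dnm_ancestor n m a v)%:R * (x v - x (p v)).
Proof.
(* With truncated subtraction, [depth] is the distance of the labels [b] and [n - 1]; it drops
   strictly from a non-root vertex to its parent. *)
move=> n1 m2 rE pE; pose depth (b : nat) := ((b - (n - 1)) + (n - 1 - b))%N.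
have [k] := ubnP (depth a); elim: k a => // k IHk a; rewrite ltnS => le_ak.
have [an|an] := eqVneq (a : nat) (n - 1)%N.
  rewrite an big1 => [|v _]; last by rewrite Dnm_ancestor_root // mul0r.
  by rewrite addr0; congr x; apply: val_inj; rewrite /= an.
have depth_p : (depth (p a) < k)%N.
  move: le_ak; rewrite pE /Dnm_parent; rewrite /depth.
  by case: ifP => ?; [|case: ifP => ?]; lia.
under eq_bigr do rewrite Dnm_ancestor_parent // -pE natrD mulrDl.
rewrite big_split /= addrCA -(IHk _ depth_p) (bigD1 a) //= eqxx mul1r.
rewrite big1 ?addr0 ?subrK // => v va; rewrite -val_eqE in va.
by rewrite (negbTE va) mul0r.
Qed.

Lemma sum_interval (n m : nat) : (1 <= n)%N -> (2 <= m)%N ->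
  (\sum_(v < 2 * n + m - 2) (n <= v < n + m - 1) = m - 1)%N.
Proof.
move=> n1 m2; rewrite -(big_mkord xpredT (fun v => nat_of_bool (n <= v < n + m - 1)%N)).
rewrite (@big_cat_nat _ _ _ n) /=; [|lia..].
rewrite (@big_cat_nat _ _ _ (n + m - 1) n) /=; [|lia..].
rewrite big_nat big1 => [|v ?]; last lia.
rewrite [X in (_ + (_ + X))%N]big_nat [X in (_ + (_ + X))%N]big1 => [|v ?]; last lia.
rewrite big_nat (eq_bigr (fun=> 1%N)) => [|v ->//].
by rewrite -big_nat sum_nat_const_nat; lia.
Qed.

(** Subtracting the two root paths cancels their common part, leaving coefficients [e] in {-1, 0,
    1}. Cauchy-Schwarz then separates the number of tree edges used from the energy of the tree. *)
Lemma Dnm_diameter {R : realType} {n m : nat} (x : 'I_(2 * n + m - 2) -> R)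
    (a b : 'I_(2 * n + m - 2)) : (1 <= n)%N -> (2 <= m)%N ->
  (x a - x b) ^+ 2 <= (m + 1)%:R * qform (laplacian R (Dnm_adj n m)) x.
Proof.
move=> n1 m2; pose p v := Ordinal (Dnm_parent_lt n m v n1 m2).
have root_lt : (n - 1 < 2 * n + m - 2)%N by lia.
pose anc (c v : 'I_(2 * n + m - 2)) : R := (Dnm_ancestor n m c v)%:R.
pose e v := anc a v - anc b v.
have pathE c : x c = x (Ordinal root_lt) + \sum_v anc c v * (x v - x (p v)).
  exact: Dnm_path_sum.
have -> : x a - x b = \sum_v e v * (x v - x (p v)).
  rewrite pathE [x b]pathE opprD addrACA subrr add0r -sumrB.
  by apply: eq_bigr => v _; rewrite -mulrBl.
apply: (le_trans (sum_CauchySchwarz _ _)).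
have forest : \sum_v (x v - x (p v)) ^+ 2 <= qform (laplacian R (Dnm_adj n m)) x.
  apply: qform_laplacian_forest; first exact: Dnm_adj_sym.
    move=> v; rewrite /Dnm_adj => ->; rewrite /= /Dnm_parent.
    have := ltn_ord v; by case: ifP => ?; [|case: ifP => ?]; lia.
  move=> u v /(congr1 val) /= vE /(congr1 val) /= uE; apply: val_inj => /=.
  move: vE uE; rewrite /Dnm_parent.
  by (case: ifP => ?; [|case: ifP => ?]); (case: ifP => ?; [|case: ifP => ?]); lia.
have e2 : \sum_v e v ^+ 2 <= (m + 1)%:R.
  pose f (v : 'I_(2 * n + m - 2)) : nat := ((v == a) + (v == b) + (n <= v < n + m - 1))%N.
  have ef v : e v ^+ 2 <= (f v)%:R.
    have : ((Dnm_ancestor n m a v != Dnm_ancestor n m b v) <= f v)%N.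
      exact: Dnm_ancestor_diff.
    rewrite /e /anc; do 2 case: (Dnm_ancestor n m _ _); rewrite ?subrr ?subr0 ?sub0r ?sqrrN
      ?expr1n ?expr0n ?ler0n ?ler1n //=.
  apply: (le_trans (ler_sum _ (fun v _ => ef v))); rewrite -natr_sum ler_nat.
  have delta (c : 'I_(2 * n + m - 2)) : (\sum_v (v == c) = 1)%N.
    by rewrite (bigD1 c) //= eqxx big1 // => v /negbTE ->.
  by rewrite !big_split /= !delta sum_interval //; lia.
apply: ler_pM => //; apply: sumr_ge0 => i _; exact: sqr_ge0.
Qed.

(** * Upper bound: the linear test vector *)

(* The position, along the path, of the path vertex nearest to [i]; the
   truncated subtraction sends the whole first clique to 0. *)
Definition Dnm_clip (n m i : nat) : nat := minn (i - (n - 1)) (m - 1).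

(** Off the path, each clique has [n - 1] vertices, all clipped to its end of the path; on the path,
    clipping is a bijection onto the positions below [m]. *)
Lemma sum_Dnm_clip {R : pzRingType} (n m : nat) (g : nat -> R) :
  (1 <= n)%N -> (2 <= m)%N ->
  \sum_(i < 2 * n + m - 2) g (Dnm_clip n m i) =
  (g 0%N + g (m - 1)%N) *+ (n - 1) + \sum_(k < m) g k.
Proof.
move=> n1 m2; rewrite -(big_mkord xpredT (fun i => g (Dnm_clip n m i))).
rewrite (@big_cat_nat _ _ _ (n - 1)) /=; [|lia..].
rewrite (@big_cat_nat _ _ _ (n + m - 1) (n - 1)) /=; [|lia..].
have -> : \sum_(0 <= i < n - 1) g (Dnm_clip n m i) = g 0%N *+ (n - 1).
  rewrite big_nat (eq_bigr (fun=> g 0%N)) => [|i ?].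
    by rewrite -big_nat sumr_const_nat subn0.
  by congr g; rewrite /Dnm_clip; lia.
have -> : \sum_(n + m - 1 <= i < 2 * n + m - 2) g (Dnm_clip n m i) =
    g (m - 1)%N *+ (n - 1).
  rewrite big_nat (eq_bigr (fun=> g (m - 1)%N)) => [|i ?].
    by rewrite -big_nat sumr_const_nat; congr (_ *+ _); lia.
  by congr g; rewrite /Dnm_clip; lia.
have -> : \sum_(n - 1 <= i < n + m - 1) g (Dnm_clip n m i) = \sum_(k < m) g k.
  rewrite -(big_mkord xpredT g) -{1}[(n - 1)%N]add0n big_addn.
  rewrite (_ : (n + m - 1 - (n - 1) = m)%N); last lia.
  rewrite big_nat [RHS]big_nat; apply: eq_bigr => i ?.
  by congr g; rewrite /Dnm_clip; lia.
by rewrite mulrnDl [X in _ + X]addrC addrA.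
Qed.

(** Here and in [sum_arith_sqr] the offset [t] is free so that induction on [p] goes through; the
    application has [t] = [p] - 1. *)
Lemma sum_arith {R : comPzRingType} (t : R) (p : nat) :
  \sum_(k < p) (2 * k%:R - t) = p%:R * (p%:R - 1 - t).
Proof.
elim: p => [|p IHp]; first by rewrite big_ord0 mul0r.
by rewrite big_ord_recr /= IHp -natr1; ring.
Qed.

Lemma sum_arith_sqr {R : comPzRingType} (t : R) (p : nat) :
  3 * \sum_(k < p) (2 * k%:R - t) ^+ 2 =
  p%:R * (2 * (p%:R - 1) * (2 * p%:R - 1) - 6 * t * (p%:R - 1) + 3 * t ^+ 2).
Proof.
elim: p => [|p IHp]; first by rewrite big_ord0 mulr0 mul0r.
by rewrite big_ord_recr /= mulrDr IHp -natr1; ring.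
Qed.

(** The edges of the path, oriented away from the first clique; the test vector changes along these
    edges only. *)
Definition Dnm_step (n m i j : nat) : bool :=
  (i.+1 == j) && (n <= j < n + m - 1)%N.

Lemma Dnm_adj_clip (n m : nat) (i j : 'I_(2 * n + m - 2)) : (1 <= n)%N -> (2 <= m)%N ->
  Dnm_adj n m i j ->
  [\/ Dnm_clip n m i = Dnm_clip n m j,
      Dnm_step n m i j /\ Dnm_clip n m j = (Dnm_clip n m i).+1 |
      Dnm_step n m j i /\ Dnm_clip n m i = (Dnm_clip n m j).+1].
Proof.
move=> n1 m2; rewrite /Dnm_adj /Dnm_step /Dnm_clip => /andP[_ /or3P[]].
- by move=> ?; apply: Or31; lia.
- by move=> ?; apply: Or31; lia.
case/and3P => /orP[] /eqP <- ? ?; [apply: Or32|apply: Or33]; rewrite eqxx /=; lia.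
Qed.

(** A step is determined by its head [j], which lies in an interval of [m - 1] labels. *)
Lemma sum_Dnm_step (n m : nat) : (1 <= n)%N -> (2 <= m)%N ->
  (\sum_(i < 2 * n + m - 2) \sum_(j < 2 * n + m - 2) Dnm_step n m i j <= m - 1)%N.
Proof.
move=> n1 m2; rewrite exchange_big -(sum_interval n m) //=.
apply: leq_sum => j _; rewrite /Dnm_step; case: (_ <= _ < _)%N; last first.
  by rewrite big1 // => i _; rewrite andbF.
have [j0|j0] := posnP j; first by rewrite j0 big1.
have lt_j : (j.-1 < 2 * n + m - 2)%N by have := ltn_ord j; lia.
rewrite (bigD1 (Ordinal lt_j)) //= big1 ?addn0 ?leq_b1 // => i.
by rewrite -val_eqE /= => ?; rewrite (_ : (_ == _) = false) //; lia.
Qed.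

(** Positions centred at the middle of the path, so that the sum is 0, and doubled to avoid halves;
    each path edge thus contributes 4 to the form. *)
Definition Dnm_test {R : pzRingType} (n m : nat) (i : 'I_(2 * n + m - 2)) : R :=
  2 * (Dnm_clip n m i)%:R - (m - 1)%:R.

Lemma qform_Dnm_test {R : realType} (n m : nat) : (1 <= n)%N -> (2 <= m)%N ->
  qform (laplacian R (Dnm_adj n m)) (Dnm_test n m) <= 4 * (m - 1)%:R.
Proof.
move=> n1 m2; rewrite -(ler_pM2l (ltr0n R 2)) qform_laplacian; last exact: Dnm_adj_sym.
pose s (i j : 'I_(2 * n + m - 2)) := nat_of_bool (Dnm_step n m i j).
(* The sum over ordered pairs meets each path edge in both orientations. *)
apply: (@le_trans _ _ (\sum_i \sum_j 4 * (s i j + s j i)%:R)).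
  apply: ler_sum => i _; apply: ler_sum => j _; rewrite /s /Dnm_test.
  have [ij|_] := boolP (Dnm_adj n m i j); last by rewrite mul0r mulr_ge0 ?ler0n.
  have [->|[-> ->]|[-> ->]] := Dnm_adj_clip _ _ _ _ n1 m2 ij.
  - by rewrite mul1r subrr expr0n mulr_ge0 ?ler0n.
  - rewrite -natr1 natrD; have := ler0n R (Dnm_step n m j i); lra.
  - rewrite -natr1 natrD; have := ler0n R (Dnm_step n m i j); lra.
under eq_bigr do rewrite -mulr_sumr -natr_sum big_split /=.
rewrite -mulr_sumr -natr_sum big_split /= [X in (_ + X)%N]exchange_big /=.
have := sum_Dnm_step n m n1 m2; rewrite -(ler_nat R) natrD /s; lra.
Qed.

Theorem theorem4p1 (R : realType) (n m : nat) :
  (1 <= n)%N -> (2 <= m)%N ->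
  2%:R / ((2 * n + m - 3)%N%:R * (m + 1)%N%:R) <= lambda2 R (Dnm_adj n m) /\
  lambda2 R (Dnm_adj n m)
    <= 12%:R / ((6 * (m - 1) * (n - 1))%N%:R + (m * (m - 1))%N%:R).
Proof.
move=> n1 m2; have N1 : (1 < 2 * n + m - 2)%N by lia.
split.
  rewrite (_ : (2 * n + m - 3 = (2 * n + m - 2).-1)%N); last lia.
  apply: lambda2_ge_pairs => //; [exact: Dnm_adj_sym|lia|].
  by move=> x a b; apply: Dnm_diameter.
have mE : m%:R = (m - 1)%:R + 1 :> R by rewrite natrB ?subrK // ltnW.
have v2 : 3 * \sum_i (Dnm_test n m i : R) ^+ 2 =
    6 * (n - 1)%:R * (m - 1)%:R ^+ 2 + (m - 1)%:R * m%:R * (m%:R + 1).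
  rewrite /Dnm_test (sum_Dnm_clip n m (fun k => (2 * k%:R - (m - 1)%:R) ^+ 2)) //.
  rewrite mulrDr sum_arith_sqr -[_ *+ (n - 1)]mulr_natr mE.
  by ring.
have m0 : 0 < (m - 1)%:R :> R by rewrite ltr0n subn_gt0.
have n0 : 0 <= (n - 1)%:R :> R by rewrite ler0n.
have den0 : 0 < (6 * (m - 1) * (n - 1))%N%:R + (m * (m - 1))%N%:R :> R.
  by rewrite -natrD ltr0n addn_gt0 !muln_gt0 subn_gt0 m2 (ltnW m2) orbT.
apply: (lambda2_le_test (Dnm_test n m)) => //.
- exact: Dnm_adj_sym.
- rewrite /Dnm_test (sum_Dnm_clip n m (fun k => 2 * k%:R - (m - 1)%:R)) //.
  by rewrite sum_arith mE -mulr_natr; ring.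
- rewrite -(pmulr_rgt0 _ (ltr0n R 3)) v2 -mulrA ltr_wpDl ?mulr_ge0 ?ler0n ?sqr_ge0 //.
  by rewrite !mulr_gt0 // ?addr_gt0 // ltr0n ltnW.
- by rewrite divr_ge0 // ltW.
- apply: (le_trans (qform_Dnm_test n m n1 m2)).
  rewrite mulrAC ler_pdivlMr // !natrM mE.
  set a := (n - 1)%:R in n0 v2 *; set k := (m - 1)%:R in m0 mE v2 *.
  set S := \sum_i _ in v2 *.
  have -> : 12 * S = 4 * (3 * S) by ring.
  rewrite v2 mE -subr_ge0.
  (* The terms in [a] cancel exactly; the slack is 4 k (k + 1) times the difference of k + 2, from
     the squared norm, and k, from the denominator. *)
  rewrite (_ : _ - _ = 4 * k * (k + 1) * 2); last by ring.
  by rewrite !mulr_ge0 ?addr_ge0 // ltW.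
Qed.
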